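(* Let $G=(V,E)$ be a finite simple graph and let $C\subseteq V$ be a minimum vertex cover of $G$. Then $C$ is the unique minimum vertex cover of $G$ if and only if for every nonempty independent set $A\subseteq C$ we have $|N_{V-C}(A)|>|A|$.
   Context: For a vertex $v$, $N(v)$ is its set of neighbors; for $X\subseteq V$, $N(X)=\bigcup_{x\in X}N(x)$, and for $S\subseteq V$, $N_S(X)=N(X)\cap S$. A vertex cover is a set of vertices meeting every edge; a minimum vertex cover is one of smallest size. *)

(* Defs.v *)
From mathcomp Require Import all_boot.

Set Implicit Arguments.
Unset Strict Implicit.
Unset Printing Implicit Defensive.

(* A finite simple graph is a finite vertex type V together with a symmetric,
   irreflexive adjacency relation e; the definitions below make sense for any
   relation, and the two properties are assumed in the theorem. *)

Definition nbhd (V : finType) (e : rel V) (v : V) : {set V} :=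
  [set w | e v w].

Definition set_nbhd (V : finType) (e : rel V) (X : {set V}) : {set V} :=
  \bigcup_(x in X) nbhd e x.

Definition nbhd_in (V : finType) (e : rel V) (S X : {set V}) : {set V} :=
  set_nbhd e X :&: S.

Definition independent (V : finType) (e : rel V) (A : {set V}) : Prop :=
  forall x y : V, x \in A -> y \in A -> ~~ e x y.

Definition vertex_cover (V : finType) (e : rel V) (C : {set V}) : Prop :=
  forall x y : V, e x y -> (x \in C) || (y \in C).

Definition minimum_vertex_cover (V : finType) (e : rel V) (C : {set V}) : Prop :=
  vertex_cover e C /\
  forall D : {set V}, vertex_cover e D -> #|C| <= #|D|.

(* Main.v *)
Require Import Defs.
From mathcomp Require Import all_boot.

(** Exchange argument: trading an independent A inside a cover C for its
    neighbours outside C gives another cover, and conversely, for two covers C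
    and D, the set C \ D is independent with all its neighbours outside C lying
    in D \ C. *)

Lemma nbhd_inP (V : finType) (e : rel V) (S X : {set V}) (y : V) :
  reflect ((exists2 x, x \in X & e x y) /\ y \in S) (y \in nbhd_in e S X).
Proof.
rewrite in_setI; apply: (iffP andP) => -[yX yS]; split=> //.
  by case/bigcupP: yX => x xX; rewrite inE => exy; exists x.
by case: yX => x xX exy; apply/bigcupP; exists x; rewrite // inE.
Qed.

(** An edge that loses its end in [A] has its other end outside [A] by independence: that end either
    stays in [C :\: A] or is one of the added neighbours. *)
Lemma exchange_vertex_cover (V : finType) (e : rel V) (C A : {set V}) :
  symmetric e -> vertex_cover e C -> independent e A ->
  vertex_cover e (C :\: A :|: nbhd_in e (~: C) A).
Proof.
move=> e_sym coverC indepA.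
(* By symmetry of [e], the end lying in [C] may be taken to be the first one. *)
suff main x y : e x y -> x \in C ->
    (x \in C :\: A :|: nbhd_in e (~: C) A)
    || (y \in C :\: A :|: nbhd_in e (~: C) A).
  move=> x y exy; case/orP: (coverC _ _ exy); first exact: main.
  by rewrite orbC; apply: main; rewrite e_sym.
move=> exy xC; have [xA|xA] := boolP (x \in A); last first.
  by rewrite in_setU in_setD xA xC.
apply/orP; right; rewrite in_setU in_setD.
have [yC|yC] := boolP (y \in C).
  by rewrite (contraL (indepA _ _ xA)) ?exy.
by apply/orP; right; apply/nbhd_inP; rewrite in_setC; split=> //; exists x.
Qed.

(** The two parts of the union are disjoint, one inside [C] and one outside. The additive form
    avoids truncated subtraction. *)
Lemma card_exchange (V : finType) (e : rel V) (C A : {set V}) :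
  A \subset C ->
  #|C :\: A :|: nbhd_in e (~: C) A| + #|A| = #|C| + #|nbhd_in e (~: C) A|.
Proof.
move=> sAC; rewrite cardsU [_ :&: nbhd_in _ _ _](_ : _ = set0); last first.
  apply/setP=> x; rewrite in_setI in_setD in_set0.
  by apply/negP=> /andP[/andP[_ xC]] /nbhd_inP[_]; rewrite in_setC xC.
by rewrite cards0 subn0 addnAC -(cardsID A C) (setIidPr sAC) (addnC #|A|).
Qed.

Lemma independent_setD_cover (V : finType) (e : rel V) (C D : {set V}) :
  vertex_cover e D -> independent e (C :\: D).
Proof.
move=> coverD x y /setDP[_ xD] /setDP[_ yD].
by apply/negP=> /coverD; rewrite (negPf xD) (negPf yD).
Qed.

(** An edge with one end outside [D] must be covered at its other end. *)
Lemma nbhd_in_setD_cover (V : finType) (e : rel V) (C D : {set V}) :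
  vertex_cover e D -> nbhd_in e (~: C) (C :\: D) \subset D :\: C.
Proof.
move=> coverD; apply/subsetP=> y /nbhd_inP[[x /setDP[_ xD] /coverD]].
by rewrite (negPf xD) in_setC in_setD => /= yD ->.
Qed.

Theorem theorem2p2 (V : finType) (e : rel V)
    (e_sym : symmetric e) (e_irrefl : irreflexive e)
    (C : {set V}) (C_min : minimum_vertex_cover e C) :
  unique (minimum_vertex_cover e) C <->
  (forall A : {set V}, A != set0 -> independent e A -> A \subset C ->
     #|A| < #|nbhd_in e (~: C) A|).
Proof.
have [coverC minC] := C_min; split=> [[_ uniqC] A A_n0 indepA sAC | ltN].
  rewrite ltnNge; apply/negP=> leNA.
  have coverD := exchange_vertex_cover _ _ _ _ e_sym coverC indepA.
  have leDC : #|C :\: A :|: nbhd_in e (~: C) A| <= #|C|.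
    by rewrite -(leq_add2r #|A|) card_exchange // leq_add2l.
  (* The exchanged cover is no larger than [C], hence minimum too, and uniqueness applies. Yet it
     misses every vertex of [A]. *)
  have eqCD : C = C :\: A :|: nbhd_in e (~: C) A.
    by apply: uniqC; split=> // D /minC; apply: leq_trans.
  case/set0Pn: A_n0 => x xA; have xC := subsetP sAC x xA.
  move: (xC); rewrite {1}eqCD in_setU in_setD xA /=.
  by move=> /nbhd_inP[_]; rewrite in_setC xC.
split=> // D [coverD minD].
have eq_card : #|C| = #|D| by apply/eqP; rewrite eqn_leq minC ?minD.
have eq_cardD : #|C :\: D| = #|D :\: C| by rewrite !cardsD setIC eq_card.
(* As the sizes agree, it suffices that [C :\: D] is empty; otherwise it serves as the set [A] in
   [ltN], with too few neighbours outside [C]. *)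
apply/eqP; rewrite eqEcard eq_card leqnn andbT -setD_eq0.
apply/negPn/negP=> CD_n0.
have := ltN _ CD_n0 (independent_setD_cover _ _ C _ coverD) (subsetDl _ _).
rewrite eq_cardD ltnNge.
by rewrite (subset_leq_card (nbhd_in_setD_cover _ _ _ _ coverD)).
Qed.
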